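(* Fix any level $a\in\mathbb{R}$, any $c_1\ge3$ and any $\Delta\in(0,\tfrac14]$. There exists a constant $\kappa>0$ (independent of $\varepsilon$) such that, for every accuracy $\varepsilon>0$, no deterministic algorithm can guarantee to output an $\varepsilon$-approximation of any $\Delta$-proper level set $\{f=a\}$ of an arbitrary convex $c_1$-gradient-Lipschitz function $f\colon[0,1]^d\to\mathbb{R}$ by querying less than $\kappa/\varepsilon^{(d-1)/2}$ of its values; i.e., for every deterministic algorithm and every positive integer $n<\kappa/\varepsilon^{(d-1)/2}$ there is a convex $c_1$-gradient-Lipschitz function $f$ with $\Delta$-proper level set $\{f=a\}$ such that the output $S_n$ of the algorithm run on $f$ is not an $\varepsilon$-approximation of $\{f=a\}$.
   Context: $d\ge1$ is an integer. $\{f=a\}:=\{x\in[0,1]^d: f(x)=a\}$. A set $S\subseteq[0,1]^d$ is an $\varepsilon$-approximation of $\{f=a\}$ if $\{f=a\}\subseteq S\subseteq\{x\in[0,1]^d:|f(x)-a|\le\varepsilon\}$. A function $f\colon[0,1]^d\to\mathbb{R}$ is $c_1$-gradient-Lipschitz if it is the restriction to $[0,1]^d$ of a continuously differentiable function defined on $\mathbb{R}^d$ (also denoted $f$) such that $\|\nabla f(x)-\nabla f(y)\|_\infty\le c_1\|x-y\|_\infty$ for all $x,y\in[0,1]^d$. The level set $\{f=a\}$ is $\Delta$-proper if $\{f=a\}\ne\varnothing$ and $\min_{x\in[0,1]^d}f(x)+\Delta\le a\le\min_{x\in\partial[0,1]^d}f(x)$, where $\partial[0,1]^d$ is the boundary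 of $[0,1]^d$. Deterministic algorithm: a pair $(\varphi,\psi)$ of sequences of maps $\varphi_n\colon\mathbb{R}^{n-1}\to[0,1]^d$ and $\psi_n\colon\mathbb{R}^n\to\{\text{subsets of }[0,1]^d\}$, $n\ge1$; run on $f$, it queries $x_n=\varphi_n(f(x_1),\dots,f(x_{n-1}))$ and outputs $S_n=\psi_n(f(x_1),\dots,f(x_n))$. *)

(* Defs.v *)
From HB Require Import structures.
From mathcomp Require Import all_boot all_order all_algebra.
From mathcomp Require Import all_classical all_reals all_analysis.
Set Implicit Arguments.
Unset Strict Implicit.
Unset Printing Implicit Defensive.
Import Order.TTheory GRing.Theory Num.Theory.
Import numFieldNormedType.Exports.
Local Open Scope classical_set_scope.
Local Open Scope ring_scope.

(** Functions on the cube [0,1]^d are represented by total functions on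
    ['rV[R]_d]; every notion below that is stated for such an [f] depends only
    on the values of [f] on the cube, except [grad] and [C1].  The norm of
    ['rV[R]_d] in the library is the sup norm. *)
Section LevelSets.
Variables (R : realType) (d : nat).
Local Notation E := 'rV[R]_d.

Definition cube : set E := [set x | forall i, 0 <= x ord0 i <= 1].

Definition boundary (A : set E) : set E := closure A `\` interior A.

Definition level_set (f : E -> R) (a : R) : set E :=
  [set x | cube x /\ f x = a].

Definition is_approximation (eps : R) (f : E -> R) (a : R) (S : set E) :=
  level_set f a `<=` S /\ S `<=` [set x | cube x /\ `|f x - a| <= eps].

Definition grad (g : E -> R) (x : E) : E :=
  \row_i 'D_(delta_mx ord0 i) g x.

Definition C1 (g : E -> R) :=
  (forall x, differentiable g x) /\ continuous (grad g).

Definition gradient_lipschitz (c1 : R) (f : E -> R) :=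
  exists g : E -> R,
    [/\ {in cube, f =1 g}, C1 g &
        {in cube &, forall x y, `|grad g x - grad g y| <= c1 * `|x - y|}].

Definition is_min_on (A : set E) (f : E -> R) (m : R) :=
  (f @` A) m /\ lbound (f @` A) m.

Definition proper_level_set (Delta : R) (f : E -> R) (a : R) :=
  level_set f a !=set0 /\
  exists m b : R,
    [/\ is_min_on cube f m, is_min_on (boundary cube) f b, m + Delta <= a
      & a <= b].

(** [query A n] maps the first [n] observed values to the [n.+1]-st query
    point, and [output A n] maps the first [n] observed values to the [n]-th
    output; [output A 0], produced before any query, plays no role in lower
    bounds over [n >= 1]. *)
Record algorithm := Algorithm {
  query : forall n : nat, n.-tuple R -> E;
  query_cube : forall n (v : n.-tuple R), cube (query v);
  output : forall n : nat, n.-tuple R -> set E;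
  output_cube : forall n (v : n.-tuple R), output v `<=` cube
}.

Fixpoint run_values (A : algorithm) (f : E -> R) (n : nat) : n.-tuple R :=
  if n is k.+1 then
    let v := run_values A f k in [tuple of rcons v (f (query A v))]
  else [tuple].

Definition run_output (A : algorithm) (f : E -> R) (n : nat) : set E :=
  output A (run_values A f n).

End LevelSets.

Arguments cube {R d}.

(* Main.v *)
(** Run the algorithm on [f0 x = |x - c|^2 + a - 1/4], with [c] the center of
    the cube and [| |] the Euclidean norm: its level set at [a] is the inscribed
    sphere.  Adding the C^1 bump [2 eps * max(0, 1 - |x - p|^2 / r^2)^2] at a
    point [p] of the sphere, with [r^2] a large enough multiple of [eps], keeps
    the function convex, its gradient Lipschitz and its level set proper, but
    moves the value at [p] from [a] to [a + 2 eps].  The sphere carries of order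
    [r^-(d-1)] points [p] with disjoint bumps; with fewer queries some bump is
    never seen, so both functions produce the same output set, which would have
    to contain [p] for [f0] and to avoid it for the bumped function. *)
Require Import Defs.
From HB Require Import structures.
From mathcomp Require Import all_boot all_order all_algebra.
From mathcomp Require Import all_classical all_reals all_analysis.
From mathcomp Require Import ring lra.
Import Order.TTheory GRing.Theory Num.Theory.
Import numFieldNormedType.Exports.
Local Open Scope classical_set_scope.
Local Open Scope ring_scope.

(** * Squared distances, caps and convexity of the bumped function *)

Definition sqdist {R : realType} {d : nat} (p x : 'rV[R]_d) : R :=
  \sum_i (x ord0 i - p ord0 i) ^+ 2.

Definition cap {R : realType} {d : nat} (p : 'rV[R]_d) (r : R) (x : 'rV[R]_d) : R :=
  Num.max 0 (1 - sqdist p x / r ^+ 2).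

(** One family holds both competitors: with [h = 0] it is the plain paraboloid, whatever [p] is, and
    with [h = 2 * eps] the perturbed one. *)
Definition bumped {R : realType} {d : nat} (c : 'rV[R]_d) (b h : R)
    (p : 'rV[R]_d) (r : R) (x : 'rV[R]_d) : R :=
  sqdist c x + b + h * cap p r x ^+ 2.

Lemma sqdist_ge0 {R : realType} {d : nat} (p x : 'rV[R]_d) : 0 <= sqdist p x.
Proof. by apply: sumr_ge0 => i _; exact: sqr_ge0. Qed.

Lemma sqdistxx {R : realType} {d : nat} (x : 'rV[R]_d) : sqdist x x = 0.
Proof. by apply: big1 => i _; rewrite subrr expr0n. Qed.

Lemma coord_le_sqdist {R : realType} {d : nat} (p x : 'rV[R]_d) (i : 'I_d) :
  (x ord0 i - p ord0 i) ^+ 2 <= sqdist p x.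
Proof.
rewrite /sqdist (bigD1 i) //= lerDl.
by apply: sumr_ge0 => j _; exact: sqr_ge0.
Qed.

(** The convexity defect does not depend on [p], so the defects coming from the paraboloid and from
    the bump can be compared. *)
Lemma sqdist_conv {R : realType} {d : nat} (p x y : 'rV[R]_d) (t : R) :
  sqdist p (t *: x + (1 - t) *: y) =
  t * sqdist p x + (1 - t) * sqdist p y - t * (1 - t) * sqdist x y.
Proof.
rewrite /sqdist !mulr_sumr -sumrN -!big_split /=.
apply: eq_bigr => i _; rewrite !mxE; ring.
Qed.

Lemma cap_ge0 {R : realType} {d : nat} (p : 'rV[R]_d) (r : R) (x : 'rV[R]_d) :
  0 <= cap p r x.
Proof. by rewrite /cap le_max lexx. Qed.

Lemma cap_le1 {R : realType} {d : nat} (p : 'rV[R]_d) (r : R) (x : 'rV[R]_d) :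
  cap p r x <= 1.
Proof. by rewrite /cap ge_max ler01 /= gerBl divr_ge0 ?sqdist_ge0 ?sqr_ge0. Qed.

Lemma capxx {R : realType} {d : nat} (p : 'rV[R]_d) (r : R) : cap p r p = 1.
Proof. by rewrite /cap sqdistxx mul0r subr0; apply/max_idPr; exact: ler01. Qed.

Lemma cap_gt0_coord {R : realType} {d : nat} (p : 'rV[R]_d) (r : R)
    (x : 'rV[R]_d) (i : 'I_d) :
  0 < r -> 0 < cap p r x -> `|x ord0 i - p ord0 i| < r.
Proof.
move=> r0; rewrite /cap lt_max ltxx /= subr_gt0 ltr_pdivrMr ?exprn_gt0 // mul1r.
move=> /(le_lt_trans (coord_le_sqdist p x i)).
by rewrite -real_normK ?num_real // ltr_pXn2r // nnegrE ?ltW.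
Qed.

Lemma cap_far {R : realType} {d : nat} (p : 'rV[R]_d) (r : R) (x : 'rV[R]_d)
    (i : 'I_d) :
  0 < r -> r <= `|x ord0 i - p ord0 i| -> cap p r x = 0.
Proof.
move=> r0 rx; apply/eqP; rewrite eq_le cap_ge0 andbT leNgt; apply/negP.
by move=> /(cap_gt0_coord p r x i r0); rewrite ltNge rx.
Qed.

(* [cap ^+ 2] is the supremum over [0 <= s <= 1] of the quadratics on the left
   (attained at [s = cap]), whose Hessians [- 4 s / r ^+ 2] are bounded below:
   adding the strongly convex [sqdist c] makes all of them convex. *)
Lemma cap_sqr_ge {R : realType} {d : nat} (p : 'rV[R]_d) (r : R)
    (x : 'rV[R]_d) (s : R) : 0 <= s ->
  2 * s * (1 - sqdist p x / r ^+ 2) - s ^+ 2 <= cap p r x ^+ 2.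
Proof.
move=> s0; rewrite /cap; set u := 1 - _.
have [u0|u0] := leP 0 u.
  by rewrite -subr_ge0 (_ : _ - _ = (u - s) ^+ 2) ?sqr_ge0 //; ring.
rewrite expr0n /= subr_le0 (@le_trans _ _ 0) ?sqr_ge0 //.
by rewrite mulr_ge0_le0 // ?mulr_ge0 // ltW.
Qed.

Lemma cap_sqrE {R : realType} {d : nat} (p : 'rV[R]_d) (r : R) (x : 'rV[R]_d) :
  cap p r x ^+ 2 =
  2 * cap p r x * (1 - sqdist p x / r ^+ 2) - cap p r x ^+ 2.
Proof. by rewrite /cap; case: leP => _; ring. Qed.

Lemma bumped_convex {R : realType} {d : nat} (A : set 'rV[R]_d)
    (c p : 'rV[R]_d) (b h r : R) :
  0 <= h -> 0 < r -> 2 * h <= r ^+ 2 ->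
  convex_function A (bumped c b h p r).
Proof.
move=> h0 r0 hr t x y _ _.
have -> : conv t x y = t%:num *: x + (1 - t%:num) *: y by [].
have -> : conv t (bumped c b h p r x : R^o) (bumped c b h p r y) =
  t%:num * bumped c b h p r x + (1 - t%:num) * bumped c b h p r y by [].
have : 0 <= t%:num <= 1 by rewrite ge0 le1.
move: t%:num => {}t /andP[t0 t1]; rewrite /bumped.
set z := _ *: _ + _.
(* With this [s], the quadratic minorant of [cap ^+ 2] is exact at [z], while it still bounds from
   below at [x] and [y]. *)
set s := cap p r z.
have s0 : 0 <= s := cap_ge0 p r z.
have s1 : s <= 1 := cap_le1 p r z.
have hx := ler_wpM2l (mulr_ge0 t0 h0) (cap_sqr_ge p r x s s0).
have t1' : 0 <= 1 - t by rewrite subr_ge0.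
have hy := ler_wpM2l (mulr_ge0 t1' h0) (cap_sqr_ge p r y s s0).
(* The gain of [sqdist c] outweighs the loss of the bump, whose relative size [s * (2 * h / r ^+ 2)]
   is at most 1. *)
have key : 0 <= t * (1 - t) * sqdist x y * (1 - s * (2 * h / r ^+ 2)).
  rewrite mulr_ge0 ?mulr_ge0 ?sqdist_ge0 // subr_ge0 mulr_ile1 //.
    by apply: divr_ge0; [exact: mulr_ge0|exact: sqr_ge0].
  by rewrite ler_pdivrMr ?exprn_gt0 // mul1r.
have sE : s ^+ 2 = 2 * s * (1 - sqdist p z / r ^+ 2) - s ^+ 2 :=
  cap_sqrE p r z.
have cz := sqdist_conv c x y t; have pz := sqdist_conv p x y t.
rewrite -/z in cz pz; rewrite sE cz pz.
by rewrite -subr_ge0; lra.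
Qed.

(** * Lipschitz estimates for the cap and its gradient field *)

Lemma cap_lipschitz {R : realType} {d : nat} (p : 'rV[R]_d) (r : R)
    (x y : 'rV[R]_d) :
  `|cap p r x - cap p r y| <= `|sqdist p x - sqdist p y| / r ^+ 2.
Proof.
have -> : `|sqdist p x - sqdist p y| / r ^+ 2 =
    `|sqdist p x / r ^+ 2 - sqdist p y / r ^+ 2|.
  by rewrite -mulrBl normrM normfV (ger0_norm (sqr_ge0 r)).
rewrite /cap; move: (_ / _) (_ / _) => u v.
have := ler_norm (u - v); have := ler_norm (v - u); rewrite (distrC v u).
move: `|u - v| => w; case: (leP 0 (1 - u)); case: (leP 0 (1 - v)) => *;
  by rewrite ler_norml; apply/andP; split; lra.
Qed.

Lemma coord_le_norm {R : realType} {d : nat} (x : 'rV[R]_d) (i : 'I_d) :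
  `|x ord0 i| <= `|x|.
Proof.
rewrite [leRHS]/Num.norm /= mx_normrE.
by apply: (@le_trans _ _ (`|x (ord0, i).1 (ord0, i).2|)) => //; exact: le_bigmax.
Qed.

Lemma norm_le_coord {R : realType} {d : nat} (x : 'rV[R]_d) (e : R) :
  0 <= e -> (forall i, `|x ord0 i| <= e) -> `|x| <= e.
Proof.
move=> e0 xe; rewrite [leLHS]/Num.norm /= mx_normrE.
by apply/bigmax_leP; split => // -[i j] _; rewrite (ord1 i).
Qed.

(** Up to a constant factor this field is the gradient of [cap p r ^+ 2]. The bound is free of [r]:
    at short range, differences of [cap] cost a factor of order [1/r] but are multiplied by a
    displacement below [r]. *)
Lemma cap_field_lipschitz {R : realType} {d : nat} (p : 'rV[R]_d) (r : R)
    (x y : 'rV[R]_d) (i : 'I_d) : 0 < r ->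
  `|cap p r x * (x ord0 i - p ord0 i) - cap p r y * (y ord0 i - p ord0 i)|
  <= (3 * d%:R + 2) * `|x - y|.
Proof.
move=> r0.
(* Now [y] has the larger cap, so unless both caps vanish [y] lies in the support. *)
wlog xy : x y / cap p r x <= cap p r y.
  move=> H; have [/H //|/ltW /H] := leP (cap p r x) (cap p r y).
  by rewrite distrC [`|y - x|]distrC.
have d0 : 0 <= 3 * d%:R :> R by rewrite mulr_ge0.
have [y0|y0] := leP (cap p r y) 0.
  have -> : cap p r y = 0 by apply/eqP; rewrite eq_le y0 cap_ge0.
  have -> : cap p r x = 0.
    by apply/eqP; rewrite eq_le cap_ge0 (le_trans xy y0).
  by rewrite !mul0r subrr normr0 mulr_ge0 // addr_ge0.
have yr j : `|y ord0 j - p ord0 j| < r by exact: cap_gt0_coord.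
have Dxy j : `|x ord0 j - y ord0 j| <= `|x - y|.
  by have := coord_le_norm (x - y) j; rewrite !mxE.
have D0 : 0 <= `|x - y| by [].
have bnd z : `|cap p r z * (z ord0 i - p ord0 i)| <= r.
  have [z0|z0] := leP (cap p r z) 0.
    have -> : cap p r z = 0 by apply/eqP; rewrite eq_le z0 cap_ge0.
    by rewrite mul0r normr0 ltW.
  rewrite normrM (ger0_norm (cap_ge0 _ _ _)) -[leRHS]mul1r.
  by apply: ler_pM; rewrite ?cap_ge0 ?cap_le1 // ltW // cap_gt0_coord.
(* At range at least [r], bounding each term by [r] is enough. *)
have [rD|Dr] := leP r `|x - y|.
  apply: (@le_trans _ _ (2 * `|x - y|)); last by rewrite ler_wpM2r // lerDr.
  rewrite (le_trans (ler_normB _ _)) // mulr_natl mulr2n.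
  by apply: lerD; exact: le_trans (bnd _) rD.
(* The cap difference is paired with the displacement of [y], the point known to be within [r] of
   [p]. *)
have -> : cap p r x * (x ord0 i - p ord0 i) - cap p r y * (y ord0 i - p ord0 i) =
  cap p r x * (x ord0 i - y ord0 i) +
  (cap p r x - cap p r y) * (y ord0 i - p ord0 i) by ring.
apply: le_trans (ler_normD _ _) _; rewrite !normrM.
have h1 : `|cap p r x| * `|x ord0 i - y ord0 i| <= `|x - y|.
  by rewrite -[leRHS]mul1r ler_pM // ger0_norm ?cap_ge0 ?cap_le1.
have h2 : `|sqdist p x - sqdist p y| <= d%:R * (`|x - y| * (3 * r)).
  rewrite /sqdist -sumrB (le_trans (ler_norm_sum _ _ _)) //.
  have -> : d%:R * (`|x - y| * (3 * r)) = \sum_(j < d) (`|x - y| * (3 * r)).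
    by rewrite sumr_const card_ord mulr_natl.
  apply: ler_sum => j _.
  have -> : (x ord0 j - p ord0 j) ^+ 2 - (y ord0 j - p ord0 j) ^+ 2 =
    (x ord0 j - y ord0 j) * ((x ord0 j - y ord0 j) + 2 * (y ord0 j - p ord0 j)).
    by ring.
  rewrite normrM ler_pM // (le_trans (ler_normD _ _)) // normrM.
  rewrite (ger0_norm (ler0n _ 2)) (_ : 3 * r = r + 2 * r); last by ring.
  apply: lerD; first by rewrite (le_trans (Dxy j)) // ltW.
  by rewrite ler_wpM2l // ltW.
have h3 : `|cap p r x - cap p r y| * `|y ord0 i - p ord0 i| <=
    3 * d%:R * `|x - y|.
  apply: (@le_trans _ _ (d%:R * (`|x - y| * (3 * r)) / r ^+ 2 * r)).
    apply: ler_pM => //; last exact: ltW.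
    rewrite (le_trans (cap_lipschitz _ _ _ _)) //.
    by rewrite ler_wpM2r // invr_ge0 sqr_ge0.
  rewrite le_eqVlt; apply/orP; left; apply/eqP; field.
  by rewrite gt_eqF.
have := lerD h1 h3; move/le_trans; apply; lra.
Qed.

(** * Differentiability and the gradient of the bumped function *)

Lemma is_diff_sum {R : numFieldType} {V W : normedModType R} (I : Type)
    (s : seq I) (f df : I -> V -> W) (x : V) :
  (forall i, is_diff x (f i) (df i)) ->
  is_diff x (\sum_(i <- s) f i) (\sum_(i <- s) df i).
Proof.
move=> fdf; elim/big_ind2 : _ => [|? ? ? ? ? ?|i _]; last exact: fdf.
  exact: is_diff_cst.
exact: is_diffD.
Qed.

Lemma is_diff_coord {R : realType} {d : nat} (i : 'I_d) (x : 'rV[R]_d) :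
  is_diff x (fun y : 'rV[R]_d => y ord0 i : R) (fun y => y ord0 i).
Proof.
apply: DiffDef; first exact: differentiable_coord.
have cl : linear (fun y : 'rV[R]_d => y ord0 i : R).
  by move=> k u v; rewrite !mxE.
pose L := GRing.isLinear.Build _ _ _ _ _ cl.
pose c : {linear 'rV[R]_d -> R} := HB.pack (fun y : 'rV[R]_d => y ord0 i : R) L.
have := @diff_lin _ _ _ c x; apply; exact: coord_continuous.
Qed.

Lemma is_diff_sqdist {R : realType} {d : nat} (p x : 'rV[R]_d) :
  is_diff x (sqdist p)
    (fun v => \sum_i 2 * (x ord0 i - p ord0 i) * v ord0 i).
Proof.
have H i : is_diff x (fun y : 'rV[R]_d => (y ord0 i - p ord0 i) ^+ 2 : R)
    (fun v => 2 * (x ord0 i - p ord0 i) * v ord0 i).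
  have H1 := is_diffX 1 (is_diffB (is_diff_coord i x) (is_diff_cst (p ord0 i) x)).
  apply: (is_diff_eq H1); apply/funext => v /=.
  by rewrite !fctE subr0 expr1.
have := is_diff_sum _ (index_enum 'I_d) _ _ _ H.
rewrite (_ : \sum_i _ = sqdist p); last first.
  by apply/funext => y; rewrite fct_sumE.
by move/is_diff_eq; apply; apply/funext => y; rewrite fct_sumE.
Qed.

(** Squaring removes the kink at 0: in every sign case the linearization error over a step [h] is at
    most [h ^+ 2]. *)
Lemma is_diff_sqr_max0 {R : realType} (t : R) :
  is_diff t (fun u : R => Num.max 0 u ^+ 2) (fun u => 2 * Num.max 0 t * u).
Proof.
have dt : is_derive t 1 (fun u : R => Num.max 0 u ^+ 2) (2 * Num.max 0 t).
  have cv : (fun h : R => h^-1 *: (Num.max 0 (h *: (1 : R) + t) ^+ 2 - Num.max 0 t ^+ 2)) @ 0^'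
    --> (2 * Num.max 0 t : R).
    apply/cvgrPdist_le => e e0; near=> h.
    have h0 : h != 0 by near: h; exact: nbhs_dnbhs_neq.
    have he : `|h| <= e.
      by near: h; apply: dnbhs0_le.
    apply: le_trans he.
    have -> : 2 * Num.max 0 t - h^-1 *: (Num.max 0 (h *: (1 : R) + t) ^+ 2 - Num.max 0 t ^+ 2)
      = h^-1 * (2 * Num.max 0 t * h - (Num.max 0 (h + t) ^+ 2 - Num.max 0 t ^+ 2)).
      by rewrite /GRing.scale /= mulr1; field.
    rewrite normrM normfV ler_pdivrMl ?normr_gt0 //.
    rewrite -[`|h| * _]normrM -expr2 [leRHS]ger0_norm ?sqr_ge0 //.
    by case: (leP 0 t); case: (leP 0 (h + t)) => *; rewrite ler_norml; apply/andP; split; nra.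
  by apply: DeriveDef; [apply/cvg_ex; eexists; exact: cv | exact: cvg_lim cv].
apply: DiffDef.
  by apply/derivable1_diffP; exact: ex_derive.
rewrite deriv1E; last exact: ex_derive.
by apply/funext => u; rewrite derive1E derive_val /GRing.scale /= mulrC.
Unshelve. all: by end_near.
Qed.

Definition bumped_grad {R : realType} {d : nat} (c : 'rV[R]_d) (h : R)
    (p : 'rV[R]_d) (r : R) (x : 'rV[R]_d) : 'rV[R]_d :=
  \row_i (2 * (x ord0 i - c ord0 i)
          - 4 * h / r ^+ 2 * (cap p r x * (x ord0 i - p ord0 i))).

Lemma is_diff_bumped {R : realType} {d : nat} (c : 'rV[R]_d) (b h : R)
    (p : 'rV[R]_d) (r : R) (x : 'rV[R]_d) :
  is_diff x (bumped c b h p r)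
    (fun v => \sum_i bumped_grad c h p r x ord0 i * v ord0 i).
Proof.
have H1 : is_diff x (fun y => 1 - sqdist p y / r ^+ 2 : R)
    (fun v => - (r ^+ 2)^-1 * \sum_i 2 * (x ord0 i - p ord0 i) * v ord0 i).
  have H := is_diffB (is_diff_cst (1 : R) x) (is_diffZ (r ^+ 2)^-1 (is_diff_sqdist p x)).
  rewrite (_ : (fun y => _) = cst (1 : R) - (r ^+ 2)^-1 *: sqdist p); last first.
    by apply/funext => y; rewrite !fctE /GRing.scale /= mulrC.
  apply: (is_diff_eq H); apply/funext => v.
  by rewrite !fctE sub0r /GRing.scale /= mulNr.
have H2 := is_diff_comp H1 (is_diff_sqr_max0 _).
have H3 := is_diffD (is_diffD (is_diff_sqdist c x) (is_diff_cst b x)) (is_diffZ h H2).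
rewrite (_ : bumped c b h p r = sqdist c + cst b +
  h *: ((fun u : R => Num.max 0 u ^+ 2) \o (fun y => 1 - sqdist p y / r ^+ 2))); last first.
  by apply/funext => y.
apply: (is_diff_eq H3); apply/funext => v.
rewrite !fctE /GRing.scale /= addr0 -/(cap p r x) !mulr_sumr -big_split /=.
by apply: eq_bigr => i _; rewrite mxE; ring.
Qed.

Lemma grad_bumped {R : realType} {d : nat} (c : 'rV[R]_d) (b h : R)
    (p : 'rV[R]_d) (r : R) :
  grad (bumped c b h p r) = bumped_grad c h p r.
Proof.
apply/funext => x; apply/rowP => i; rewrite [LHS]mxE.
have H := is_diff_bumped c b h p r x.
rewrite deriveE; last exact: ex_diff.
rewrite diff_val (bigD1 i) //= [X in _ * X + _]mxE !eqxx mulr1 big1 ?addr0 // => j ji.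
by rewrite [X in _ * X]mxE (negbTE ji) andbF mulr0.
Qed.

(** The constant is 3 = 2 + 1: the paraboloid contributes 2, and the bound on [h] keeps the bump's
    share at most 1. *)
Lemma bumped_grad_lipschitz {R : realType} {d : nat} (c : 'rV[R]_d) (h : R)
    (p : 'rV[R]_d) (r : R) (x y : 'rV[R]_d) :
  0 < r -> 0 <= h -> 4 * (3 * d%:R + 2) * h <= r ^+ 2 ->
  `|bumped_grad c h p r x - bumped_grad c h p r y| <= 3 * `|x - y|.
Proof.
move=> r0 h0 hr; apply: norm_le_coord => [|i]; first by rewrite mulr_ge0.
rewrite !mxE.
set X := cap p r x * _; set Y := cap p r y * _; set k := _ / _.
have -> : 2 * (x ord0 i - c ord0 i) - k * X - (2 * (y ord0 i - c ord0 i) - k * Y)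
  = 2 * (x ord0 i - y ord0 i) - k * (X - Y) by ring.
have k0 : 0 <= k by apply: divr_ge0; [exact: mulr_ge0|exact: sqr_ge0].
have k1 : k * (3 * d%:R + 2) <= 1.
  rewrite /k mulrAC ler_pdivrMr ?exprn_gt0 // mul1r; apply: le_trans hr.
  by rewrite le_eqVlt; apply/orP; left; apply/eqP; ring.
move: k k0 k1 => k k0 k1.
apply: le_trans (ler_normB _ _) _; rewrite !normrM (ger0_norm (ler0n _ 2)).
have h1 : `|x ord0 i - y ord0 i| <= `|x - y|.
  by have := coord_le_norm (x - y) i; rewrite !mxE.
have h2 : `|k| * `|X - Y| <= `|x - y|.
  rewrite ger0_norm // (le_trans (ler_wpM2l k0 (cap_field_lipschitz p r x y i r0))) //.
  by rewrite mulrA -[leRHS]mul1r ler_wpM2r.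
by lra.
Qed.

Lemma lipschitz_continuous {R : realType} {V W : normedModType R} (k : R) (f : V -> W) :
  (forall x y, `|f x - f y| <= k * `|x - y|) -> continuous f.
Proof.
move=> fk x; apply/cvgrPdist_le => e e0.
(* [k] itself may be zero or negative. *)
have k1 : 0 < `|k| + 1 by rewrite ltr_wpDl.
near=> y.
apply: le_trans (fk _ _) _; apply: (@le_trans _ _ ((`|k| + 1) * `|x - y|)).
  by rewrite ler_wpM2r // (le_trans (ler_norm k)) // lerDl.
rewrite -ler_pdivlMl //; near: y.
by apply: cvgr_dist_le; [exact: cvg_id | rewrite mulr_gt0 // invr_gt0].
Unshelve. all: by end_near.
Qed.

Lemma bumped_gradient_lipschitz {R : realType} {d : nat} (c : 'rV[R]_d)
    (b h : R) (p : 'rV[R]_d) (r c1 : R) :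
  3 <= c1 -> 0 < r -> 0 <= h -> 4 * (3 * d%:R + 2) * h <= r ^+ 2 ->
  gradient_lipschitz c1 (bumped c b h p r).
Proof.
move=> c13 r0 h0 hr; exists (bumped c b h p r); split => //.
  split=> [x|]; first by have H := is_diff_bumped c b h p r x; exact: ex_diff.
  rewrite grad_bumped; apply: lipschitz_continuous => x y.
  exact: bumped_grad_lipschitz.
move=> x y _ _; rewrite grad_bumped.
apply: le_trans (bumped_grad_lipschitz c h p r x y r0 h0 hr) _.
by rewrite ler_wpM2r.
Qed.

(** * The inscribed sphere and properness of the level set *)

Definition cube_center {R : realType} {d : nat} : 'rV[R]_d := const_mx 2^-1.

Lemma cube_sqdist_center {R : realType} {d : nat} (x : 'rV[R]_d) :
  sqdist cube_center x <= 4^-1 -> cube x.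
Proof.
move=> hx i; have := le_trans (coord_le_sqdist cube_center x i) hx.
rewrite mxE => h; nra.
Qed.

(** The open inscribed ball is an open subset of the cube, hence lies in its interior. *)
Lemma boundary_cube_sqdist {R : realType} {d : nat} (x : 'rV[R]_d) :
  boundary cube x -> 4^-1 <= sqdist cube_center x.
Proof.
move=> -[_ xI]; rewrite leNgt; apply/negP => hx; apply: xI.
have op : open [set y : 'rV[R]_d | sqdist cube_center y < 4^-1].
  have cs : continuous (sqdist (cube_center : 'rV[R]_d)).
    move=> y; apply: differentiable_continuous.
    by have H := is_diff_sqdist cube_center y; exact: ex_diff.
  have := @open_comp _ _ (sqdist cube_center) [set u : R | u < 4^-1] (fun y _ => cs y).
  by apply; exact: open_lt.
have sub : [set y : 'rV[R]_d | sqdist cube_center y < 4^-1] `<=` cube.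
  by move=> y /ltW /cube_sqdist_center.
by move: sub; rewrite open_subsetE //; apply.
Qed.

(** The point where the inscribed sphere touches the face [x_i = 0]. *)
Definition face_center {R : realType} {d : nat} (i : 'I_d) : 'rV[R]_d :=
  cube_center - 2^-1 *: delta_mx ord0 i.

Lemma face_centerE {R : realType} {d : nat} (i j : 'I_d) :
  (face_center i : 'rV[R]_d) ord0 j = 2^-1 - (j == i)%:R / 2.
Proof. by rewrite !mxE eqxx /= mulrC. Qed.

Lemma sqdist_face_center {R : realType} {d : nat} (i : 'I_d) :
  sqdist cube_center (face_center i : 'rV[R]_d) = 4^-1.
Proof.
rewrite /sqdist (bigD1 i) //= big1 => [|j ji]; rewrite face_centerE mxE.
  by rewrite eqxx /=; field.
by rewrite (negbTE ji) mul0r subr0 subrr expr0n.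
Qed.

Lemma cube_face_center {R : realType} {d : nat} (i : 'I_d) :
  cube (face_center i : 'rV[R]_d).
Proof. by apply: cube_sqdist_center; rewrite sqdist_face_center. Qed.

Lemma boundary_face_center {R : realType} {d : nat} (i : 'I_d) :
  boundary cube (face_center i : 'rV[R]_d).
Proof.
split; first exact/subset_closure/cube_face_center.
move=> /nbhs_ballP [e /= e0 sub].
have e20 : 0 <= e / 2 by rewrite divr_ge0 // ltW.
(* A shift by [e / 2] across the face stays in the ball but makes coordinate [i] negative. *)
have /sub/(_ i) : ball (face_center i : 'rV[R]_d) e
    (face_center i - (e / 2) *: delta_mx ord0 i).
  rewrite -ball_normE /ball_ /= opprB addrC subrK.
  apply: (@le_lt_trans _ _ (e / 2)); last by rewrite ltr_pdivrMr // ltr_pMr // ltr1n.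
  apply: norm_le_coord => // j; rewrite !mxE /= ger0_norm; last exact: mulr_ge0.
  by rewrite ler_piMr // lern1 leq_b1.
rewrite mxE face_centerE !mxE !eqxx /=; lra.
Qed.

(** The bump is nonnegative and vanishes at the center and at one tangency point, so the minima over
    the cube and its boundary remain [a - 4^-1] and [a], attained there. *)
Lemma bumped_proper {R : realType} {d : nat} (p : 'rV[R]_d) (a h r Delta : R)
    (i : 'I_d) :
  0 <= h -> Delta <= 4^-1 -> cap p r cube_center = 0 -> cap p r (face_center i) = 0 ->
  proper_level_set Delta (bumped cube_center (a - 4^-1) h p r) a.
Proof.
move=> h0 hD cc cf; set f := bumped _ _ _ _ _.
have fge x : sqdist cube_center x + (a - 4^-1) <= f x.
  by rewrite lerDl mulr_ge0 // sqr_ge0.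
have ff : f (face_center i) = a.
  by rewrite /f /bumped cf sqdist_face_center expr0n mulr0 addr0 addrC subrK.
have fc : f cube_center = a - 4^-1.
  by rewrite /f /bumped cc sqdistxx expr0n mulr0 addr0 add0r.
split; first by exists (face_center i); split; first exact: cube_face_center.
exists (a - 4^-1), a; split.
- split; first by exists cube_center => //; apply: cube_sqdist_center; rewrite sqdistxx invr_ge0.
  move=> _ [x _ <-]; apply: le_trans (fge x).
  by rewrite lerDr sqdist_ge0.
- split; first by exists (face_center i) => //; exact: boundary_face_center.
  move=> _ [x /boundary_cube_sqdist hx <-]; apply: le_trans (fge x).
  by move: (sqdist _ _) hx => u; lra.
- by lra.
- exact: lexx.
Qed.

(** * Points on the sphere with disjoint caps *)

(** All coordinates but the first run over a mesh of step [2 * r]; the first one lifts the mesh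
    point to the sphere, on the half away from [face_center ord0]. *)
Definition grid_point {R : realType} {d M : nat} (r : R)
    (k : {ffun 'I_d -> 'I_M}) : 'rV[R]_d.+1 :=
  \row_i if unlift ord0 i is Some j then 2^-1 + 2 * r * (k j)%:R
         else 2^-1 + Num.sqrt (4^-1 - \sum_j (2 * r * (k j)%:R) ^+ 2).

Lemma grid_point_lift {R : realType} {d M : nat} (r : R)
    (k : {ffun 'I_d -> 'I_M}) (j : 'I_d) :
  grid_point r k ord0 (lift ord0 j) = 2^-1 + 2 * r * (k j)%:R.
Proof. by rewrite mxE liftK. Qed.

(** The size condition keeps the radicand nonnegative: each mesh offset is at most [q], and
    [d.+1%:R * q ^+ 2 <= 4^-1]. *)
Lemma sqdist_grid_point {R : realType} {d M : nat} (r : R)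
    (k : {ffun 'I_d -> 'I_M}) :
  0 <= r -> 4 * r * M%:R * d.+1%:R <= 1 ->
  sqdist cube_center (grid_point r k) = 4^-1.
Proof.
move=> r0 hr; rewrite /sqdist big_ord_recl.
under eq_bigr do rewrite grid_point_lift mxE addrC addKr.
rewrite !mxE unlift_none (addrC (2^-1 + _)) addKr sqr_sqrtr ?subrK //.
rewrite subr_ge0; set q := 2 * r * M%:R.
have q0 : 0 <= q by rewrite !mulr_ge0.
have qd : 2 * q * d.+1%:R <= 1.
  by apply: le_trans hr; rewrite le_eqVlt; apply/orP; left; apply/eqP; rewrite /q; ring.
have d1 : 1 <= d.+1%:R :> R by rewrite ler1n.
apply: (@le_trans _ _ (\sum_(j < d) q ^+ 2)).
  apply: ler_sum => j _; rewrite ler_sqr ?nnegrE ?mulr_ge0 //.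
  by rewrite ler_wpM2l ?mulr_ge0 // ler_nat ltnW.
rewrite sumr_const card_ord -[leLHS]mulr_natl.
apply: (@le_trans _ _ (d.+1%:R * q ^+ 2)); first by rewrite ler_wpM2r ?ler_nat // exprn_ge0.
by move: d.+1%:R d1 qd => D d1 qd; nra.
Qed.

(** Each mesh coordinate of [x] is at distance less than [r] from two mesh values, which differ by a
    multiple of [2 * r]. *)
Lemma grid_point_cap_inj {R : realType} {d M : nat} (r : R)
    (k l : {ffun 'I_d -> 'I_M}) (x : 'rV[R]_d.+1) :
  0 < r -> 0 < cap (grid_point r k) r x -> 0 < cap (grid_point r l) r x -> k = l.
Proof.
move=> r0 hk hl; apply/ffunP => j; apply/val_inj => /=.
have := cap_gt0_coord _ _ _ (lift ord0 j) r0 hk.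
have := cap_gt0_coord _ _ _ (lift ord0 j) r0 hl.
rewrite !grid_point_lift !ltr_norml => /andP[h1 h2] /andP[h3 h4].
have [lt|gt|//] := ltngtP (k j) (l j); exfalso.
  have : (k j)%:R + 1 <= (l j)%:R :> R by rewrite natr1 ler_nat.
  move: h1 h2 h3 h4; move: (k j)%:R (l j)%:R => u v; nra.
have : (l j)%:R + 1 <= (k j)%:R :> R by rewrite natr1 ler_nat.
by move: h1 h2 h3 h4; move: (k j)%:R (l j)%:R => u v; nra.
Qed.

(** * Indistinguishable functions and the lower bound *)

Lemma run_values_eq {R : realType} {d : nat} (A : algorithm R d)
    (f g : 'rV[R]_d -> R) (n : nat) :
  (forall k, (k < n)%N -> f (query A (run_values A f k)) =
                         g (query A (run_values A f k))) ->
  run_values A f n = run_values A g n.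
Proof.
elim: n => //= n IH fg; rewrite -IH => [|k kn]; last by apply: fg; exact: ltnW.
by rewrite fg.
Qed.

(** Pigeonhole: otherwise choosing a query inside each cap would inject [M ^ d] indices into [n]
    queries, the caps being disjoint. *)
Lemma exists_unqueried_cap {R : realType} {d M n : nat} (r : R)
    (q : 'I_n -> 'rV[R]_d.+1) :
  0 < r -> (n < M ^ d)%N ->
  exists k : {ffun 'I_d -> 'I_M}, forall j, cap (grid_point r k) r (q j) = 0.
Proof.
move=> r0; apply: contraPP => /forallNP H; apply/negP; rewrite -leqNgt.
have /choice[F FP] : forall k : {ffun 'I_d -> 'I_M},
    exists j, 0 < cap (grid_point r k) r (q j).
  move=> k; have /existsNP[j /eqP hj] := H k.
  by exists j; rewrite lt_neqAle eq_sym hj cap_ge0.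
have Finj : injective F.
  move=> k l kl; apply: (grid_point_cap_inj r k l (q (F k)) r0 (FP k)).
  by rewrite kl.
by have := leq_card F Finj; rewrite card_ffun !card_ord.
Qed.

Lemma fooling_pair {R : realType} {d M n : nat} (a c1 Delta eps r : R)
    (A : algorithm R d.+1) :
  3 <= c1 -> Delta <= 4^-1 -> 0 < eps -> 0 < r -> r <= 2^-1 ->
  4 * r * M%:R * d.+1%:R <= 1 -> 8 * (3 * d.+1%:R + 2) * eps <= r ^+ 2 ->
  (n < M ^ d)%N ->
  exists f : 'rV[R]_d.+1 -> R,
    [/\ convex_function cube f, gradient_lipschitz c1 f,
        proper_level_set Delta f a & ~ is_approximation eps f a (run_output A f n)].
Proof.
move=> hc1 hD e0 r0 r2 hM hr nM.
pose F h p := bumped cube_center (a - 4^-1) h p r : 'rV[R]_d.+1 -> R.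
(* The queries must be fixed before [p] is chosen, hence the dummy center 0 at amplitude 0. *)
pose q (j : 'I_n) := query A (run_values A (F 0 0) j).
have [k kq] := exists_unqueried_cap r q r0 nM.
set p := grid_point r k in kq.
have F0 : F 0 p = F 0 0 by apply/funext => x; rewrite /F /bumped !mul0r.
have cp : sqdist cube_center p = 4^-1 by apply: sqdist_grid_point => //; exact: ltW.
have cc : cap p r cube_center = 0.
  have -> : cap p r cube_center = Num.max 0 (1 - 4^-1 / r ^+ 2).
    rewrite /cap -cp; congr (Num.max _ (1 - _ / _)).
    by apply: eq_bigr => i _; ring.
  apply/max_idPl; rewrite subr_le0 ler_pdivlMr ?exprn_gt0 // mul1r.
  nra.
(* The first coordinate is 0 at [face_center ord0] and at least 1/2 at [p]. *)
have cf : cap p r (face_center ord0) = 0.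
  apply: (cap_far p r _ ord0 r0); apply: (le_trans r2).
  rewrite face_centerE eqxx /= mxE unlift_none.
  set s := Num.sqrt _; have s0 : 0 <= s := sqrtr_ge0 _.
  by rewrite ler0_norm; lra.
have good (h : R) : 0 <= h <= 2 * eps -> [/\ convex_function cube (F h p),
    gradient_lipschitz c1 (F h p) & proper_level_set Delta (F h p) a].
  move=> /andP[h0 h2]; have d0 : 0 <= d.+1%:R :> R by [].
  have hr' : 4 * (3 * d.+1%:R + 2) * h <= r ^+ 2 by move: d.+1%:R d0 hr => D; nra.
  split.
  - apply: bumped_convex => //; apply: le_trans hr'.
    by have := mulr_ge0 d0 h0; lra.
  - exact: bumped_gradient_lipschitz.
  - exact: bumped_proper cf.
have [C0 L0 P0] : [/\ convex_function cube (F 0 p),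
    gradient_lipschitz c1 (F 0 p) & proper_level_set Delta (F 0 p) a].
  by apply: good; rewrite lexx mulr_ge0 // ltW.
have [C1 L1 P1] : [/\ convex_function cube (F (2 * eps) p),
    gradient_lipschitz c1 (F (2 * eps) p) &
    proper_level_set Delta (F (2 * eps) p) a].
  by apply: good; rewrite lexx mulr_ge0 // ltW.
have same : run_output A (F 0 p) n = run_output A (F (2 * eps) p) n.
  rewrite /run_output (run_values_eq A (F 0 p) (F (2 * eps) p)) // => j jn.
  by have := kq (Ordinal jn); rewrite /q /= -F0 /F /bumped => ->; rewrite expr0n !mulr0.
(* Either the output already fails for the paraboloid, or it contains [p], where the bumped function
   equals [a + 2 * eps]. *)
have [ap0|] := pselect (is_approximation eps (F 0 p) a (run_output A (F 0 p) n)); last first.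
  by exists (F 0 p).
exists (F (2 * eps) p); split=> // -[_]; rewrite -same.
have lp : level_set (F 0 p) a p.
  split; first by apply: cube_sqdist_center; rewrite cp.
  by rewrite /F /bumped cp mul0r addr0 addrC subrK.
move=> /(_ p (ap0.1 p lp)) [_].
rewrite /F /bumped cp capxx expr1n mulr1 [4^-1 + _]addrC subrK addrC addKr.
have : 0 <= 2 * eps by rewrite mulr_ge0 // ltW.
by move=> e2; rewrite ger0_norm //; lra.
Qed.

Theorem theorem5 (R : realType) (d : nat) (hd : (0 < d)%N) (a c1 Delta : R)
    (hc1 : 3 <= c1) (hDelta0 : 0 < Delta) (hDelta : Delta <= 4^-1) :
  exists kappa : R, 0 < kappa /\
    forall (eps : R), 0 < eps ->
    forall (A : algorithm R d) (n : nat), (0 < n)%N ->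
      n%:R < kappa / eps `^ ((d%:R - 1) / 2) ->
      exists f : 'rV[R]_d -> R,
        [/\ convex_function cube f,
            gradient_lipschitz c1 f,
            proper_level_set Delta f a &
            ~ is_approximation eps f a (run_output A f n)].
Proof.
case: d hd => // d _.
(* [C] is the factor of [eps] in the smoothness condition of [fooling_pair], so [r ^+ 2 = C * eps]
   below meets it with equality. *)
pose C : R := 8 * (3 * d.+1%:R + 2).
have C0 : 0 < C by rewrite mulr_gt0 // ltr_wpDl // mulr_ge0.
have sC0 : 0 < Num.sqrt C by rewrite sqrtr_gt0.
exists ((8 * d.+1%:R * Num.sqrt C)^-1 ^+ d); split.
  by rewrite exprn_gt0 // invr_gt0 !mulr_gt0.
move=> eps e0 A n n0.
pose r := Num.sqrt (C * eps).
have r0 : 0 < r by rewrite sqrtr_gt0 mulr_gt0.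
(* [T] is half the largest real mesh size that fits on the sphere at spacing [2 * r]; [kappa] is
   chosen so that the query bound reads [n < T ^ d]. *)
pose T := (8 * d.+1%:R * r)^-1.
have T0 : 0 < T by rewrite invr_gt0 !mulr_gt0.
have Tr : 8 * d.+1%:R * r * T = 1.
  by rewrite divff // gt_eqF // !mulr_gt0.
have -> : (8 * d.+1%:R * Num.sqrt C)^-1 ^+ d / eps `^ ((d.+1%:R - 1) / 2) = T ^+ d.
  have -> : (d.+1%:R - 1) / 2 = 2^-1 * d%:R :> R by rewrite -natr1 addrK mulrC.
  rewrite powRrM.
  rewrite [X in _ / X](_ : _ = Num.sqrt eps ^+ d); last first.
    by rewrite powR_mulrn ?powR_ge0 // -powR12_sqrt // ltW.
  rewrite -exprVn -exprMn -invfM /T /r (sqrtrM eps (ltW C0)).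
  by congr (_^-1 ^+ _); ring.
move=> nT.
(* If [T <= 1], as for large [eps], no positive [n] satisfies the query bound. *)
have T1 : 1 < T.
  rewrite ltNge; apply/negP => T1; have : T ^+ d <= 1 by rewrite exprn_ile1 // ltW.
  by move=> /(lt_le_trans nT); rewrite ltrn1 ltnNge n0.
(* Since [T > 1], rounding [2 * T] down still leaves [T <= M]. *)
pose M := Num.truncn (2 * T).
have /andP[M1 M2] : M%:R <= 2 * T < M.+1%:R by apply: truncn_itv; rewrite mulr_ge0 // ltW.
have TM : T <= M%:R by rewrite -natr1 in M2; lra.
have d1 : 1 <= d.+1%:R :> R by rewrite ler1n.
apply: (@fooling_pair R d M n a c1 Delta eps r A) => //.
- by have := ler_wpM2l (ltW r0) (mulr_ege1 d1 (ltW T1)); lra.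
- rewrite [leRHS](_ : _ = 4 * r * (2 * T) * d.+1%:R); last by rewrite -[LHS]Tr; ring.
  by rewrite ler_wpM2r // ler_wpM2l // mulr_ge0 // ltW.
- by rewrite sqr_sqrtr // mulr_ge0 // ltW.
- rewrite -(ltr_nat R) natrX; apply: lt_le_trans nT _.
  by apply: lerXn2r; rewrite ?nnegrE // ltW.
Qed.
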